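(* Any solution $(P^\star,\Sigma^\star,M^\star)$ of the impulsive optimal steering two-point boundary value problem (TPBVP) satisfies the steering condition $EX^\star(t_0+T;M^\star)E^*=X_1^f$. Conversely, any $M^\star$ satisfying the steering condition generates a solution of the TPBVP via $P^\star=P(\cdot;M^\star)$ and forward integration of the moment equations $\dot\Sigma=\mathcal A_{\mathrm{cl}}(t,P^\star(t))[\Sigma]$, $\Sigma(t_k^+)=\mathcal B_{\mathrm{cl},k}(P^\star(t_k^+),P^\star(t_k^-))[\Sigma(t_k^-)]$ from $\Sigma(t_0)=X_1^0$. The optimal cost is $J^\star=\langle P^\star(t_0),X_1^0\rangle-\langle M^\star,X_1^f\rangle$.
   Context: Notation. Fix integers $n,m\ge1$, $T>0$ and $X_1^0,X_1^f\in\mathbb H^n_{\succeq0}$. $\mathbb H^p$, $\mathbb H^p_{\succeq0}$: $p\times p$ complex Hermitian, resp. positive semidefinite, matrices; $\langle A,B\rangle=\operatorname{trace}(AB^* )$; $A^\dagger$ is the Moore–Penrose pseudoinverse. $E=[I_n\ \ 0]\in\mathbb C^{n\times(n+m)}$. Write $X=\begin{bmatrix}X_1&X_2^*\\ X_2&X_3\end{bmatrix}$ with $X_1=EXE^*$. System. Jump times $t_1<t_2<\cdots$, $t_k\to\infty$, those in $(t_0,t_0+T)$ being $t_1,\dots,t_{N_T}$; dynamics $$E\dot X(t)E^*=\mathcal F(t,X(t))\ (t\ne t_k),\quad EX(t_k^+)E^*=\mathcal J(k,X(t_k^-)),\quad EX(t_0)E^*=X_1^0.$$ $\mathcal F(t,\cdot),\mathcal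 J(k,\cdot):\mathbb H^{n+m}\to\mathbb H^n$ are linear and bounded, $\mathcal F$ is continuous in $t$, both leave the positive semidefinite cone invariant (the state block stays positive semidefinite); adjoints: $\langle P,\mathcal F(t,X)\rangle=\langle\mathcal F^*(t,P),X\rangle$, $\langle P,\mathcal J(k,X)\rangle=\langle\mathcal J^*(k,P),X\rangle$. A trajectory is an $\mathbb H^{n+m}_{\succeq0}$-valued function satisfying these equations (regular enough that the limits and integrals involved make sense); $X_2,X_3$ are free. Steering problem. With $Z(t)\succeq0$, $Z_k\succeq0$ in $\mathbb H^{n+m}$, $J^\star=J^\star(X_1^0,X_1^f)$ is the infimum of $\int_{t_0}^{t_0+T}\langle Z(t),X(t)\rangle dt+\sum_{k=1}^{N_T}\langle Z_k,X(t_k^-)\rangle$ over trajectories with $EX(t_0+T)E^*=X_1^f$. Riccati equation. $\mathcal C_Z(t,P(t))=E^*\dot P(t)E+\mathcal F^*(t,P(t))+Z(t)$, $\mathcal D_Z(k,P(t_k^+),P(t_k^-))=\mathcal J^*(k,P(t_k^+))-E^*P(t_k^-)E+Z_k$. Partition $\mathcal L\in\mathbb H^{n+m}$ as $\begin{bmatrix}\mathcal L_1&\mathcal L_2\\ \mathcal L_2^*&\mathcal L_3\end{bmatrix}$ with $\mathcal L_1\in\mathbb H^n$, $\mathcal L_3\in\mathbb H^m$. A piecewise-$C^1$ $P$ (continuous and piecewise $C^1$ between jumps, one-sided limits at jumps) solves the impulsive generalized Riccati equation if $\mathcal L=\mathcal C_Z(t,P(t))$ (a.e. $t$) and $\mathcal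 L=\mathcal D_Z(k,P(t_k^+),P(t_k^-))$ ($k=1,\dots,N_T$) satisfy $\mathcal L\succeq0$ and $\mathcal L_1-\mathcal L_2\mathcal L_3^\dagger\mathcal L_2^*=0$. For $M\succeq0$, $P(\cdot;M)$ is its solution with $P(t_0+T;M)=M$. Closed loop. Put $K(t;P)=-(\mathcal C_Z)_3(t,P(t))^\dagger(\mathcal C_Z)_2(t,P(t))^*$ and $K_k=-(\mathcal D_Z)_3^\dagger(\mathcal D_Z)_2^*$ evaluated at $(k,P(t_k^+),P(t_k^-))$, and $$\mathcal A_{\mathrm{cl}}(t,P(t))[\Sigma]=\mathcal F\!\left(t,\begin{bmatrix}\Sigma&\Sigma K^*\\ K\Sigma&K\Sigma K^*\end{bmatrix}\right),\qquad \mathcal B_{\mathrm{cl},k}(P(t_k^+),P(t_k^-))[\Sigma]=\mathcal J\!\left(k,\begin{bmatrix}\Sigma&\Sigma K_k^*\\ K_k\Sigma&K_k\Sigma K_k^*\end{bmatrix}\right).$$ $X^\star(\cdot;M)$ is the optimal trajectory of the unconstrained problem with terminal weight $M$, i.e. the minimization of $\int_{t_0}^{t_0+T}\langle Z(t),X(t)\rangle dt+\sum_{k=1}^{N_T}\langle Z_k,X(t_k^-)\rangle+\langle M,EX(t_0+T)E^*\rangle$ over trajectories with $EX(t_0)E^*=X_1^0$ and no terminal constraint, realized with the gains $K=K(t;P)$ and $K_k$ for $P=P(\cdot;M)$: $X_2^\star=KX_1^\star$, $X_3^\star=KX_1^\star K^*$ on flow, and the same with $K_k$ at $t_k^-$.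 TPBVP. Find $(P,\Sigma,M^\star)$, $M^\star\succeq0$, such that $P$ solves the impulsive generalized Riccati equation on $[t_0,t_0+T]$; $\dot\Sigma=\mathcal A_{\mathrm{cl}}(t,P(t))[\Sigma]$ between jumps; $\Sigma(t_k^+)=\mathcal B_{\mathrm{cl},k}(P(t_k^+),P(t_k^-))[\Sigma(t_k^-)]$ at each jump; and $\Sigma(t_0)=X_1^0$, $P(t_0+T)=M^\star$, $\Sigma(t_0+T)=X_1^f$. *)

(* Defs.v *)
From HB Require Import structures.
From mathcomp Require Import all_boot all_order all_algebra.
From mathcomp Require Import sesquilinear spectral complex.
From mathcomp Require Import all_classical all_reals all_analysis.
Set Implicit Arguments.
Unset Strict Implicit.
Unset Printing Implicit Defensive.
Import Order.TTheory GRing.Theory Num.Theory.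
Import numFieldNormedType.Exports.
Local Open Scope classical_set_scope.
Local Open Scope complex_scope.
Local Open Scope sesquilinear_scope.
Local Open Scope ring_scope.

(* * Complex matrices *)

Section Matrices.
Variable R : realType.
Local Notation C := R[i].

(* For z : C, [0 <= z] means that z is real and nonnegative. *)
Definition psdmx p (A : 'M[C]_p) : Prop :=
  A \is hermsymmx /\ forall v : 'cV[C]_p, 0 <= (v ^t* *m A *m v) 0 0.

(* <A, B> is real when A and B are Hermitian, so that [Re <A, B>] below is the
   same number, read in R. *)
Definition mxip p q (A B : 'M[C]_(p, q)) : C := \tr (A *m B ^t*).

Definition is_mpinv p q (A : 'M[C]_(p, q)) (B : 'M[C]_(q, p)) : Prop :=
  [/\ A *m B *m A = A, B *m A *m B = B,
      (A *m B) ^t* = A *m B & (B *m A) ^t* = B *m A].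

Definition mpinv p q (A : 'M[C]_(p, q)) : 'M[C]_(q, p) :=
  xget 0 [set B | is_mpinv A B].

(* The Penrose equations have a solution: for a full rank factorization A = B D,
   it is D^* (D D^* )^-1 (B^* B)^-1 B^*. *)
Lemma row_free_gram_unit p q (D : 'M[C]_(p, q)) :
  row_free D -> D *m D ^t* \in unitmx.
Proof.
move=> freeD; rewrite -row_free_unit; apply/row_freeP.
have /row_freeP[V VP] : row_free (D *m D ^t*); last by exists V.
rewrite -kermx_eq0; apply/rowV0P => x /sub_kermxP; rewrite mulmxA => xDD0.
have : (x *m D) *m (x *m D) ^t* = 0.
  by rewrite trmx_mul map_mxM mulmxA xDD0 mul0mx.
move=> /matrixP/(_ 0 0); rewrite !mxE => /eqP.
rewrite psumr_eq0 => [/allP xD0|j _]; last first.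
  by rewrite !mxE -normCK exprn_ge0.
apply: (row_free_inj freeD); rewrite mul0mx.
apply/matrixP => i j; rewrite ord1 [RHS]mxE.
have := xD0 j (mem_index_enum _); rewrite !mxE -normCK expf_eq0 /=.
by rewrite normr_eq0 => /eqP.
Qed.

Lemma trmxC_mul p q r (A : 'M[C]_(p, q)) (B : 'M[C]_(q, r)) :
  (A *m B) ^t* = B ^t* *m A ^t*.
Proof. by rewrite trmx_mul map_mxM. Qed.

Lemma trmxC_inv p (A : 'M[C]_p) : (invmx A) ^t* = invmx (A ^t*).
Proof. by rewrite trmx_inv map_invmx. Qed.

Lemma full_rank_mpinv p q r (B : 'M[C]_(p, r)) (D : 'M[C]_(r, q)) :
  row_free (B ^t*) -> row_free D ->
  is_mpinv (B *m D)
    (D ^t* *m invmx (D *m D ^t*) *m invmx (B ^t* *m B) *m B ^t*).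
Proof.
move=> freeB freeD.
have Uu := row_free_gram_unit freeD.
have Vu := row_free_gram_unit freeB; rewrite trmxCK in Vu.
have : (D *m D ^t*) ^t* = D *m D ^t* by rewrite trmxC_mul trmxCK.
have : (B ^t* *m B) ^t* = B ^t* *m B by rewrite trmxC_mul trmxCK.
move: Uu Vu; set U := D *m D ^t*; set V := B ^t* *m B => Uu Vu Vh Uh.
set X := D ^t* *m _ *m _ *m _.
have e1 : B *m D *m X = B *m invmx V *m B ^t*.
  by rewrite /X !mulmxA -(mulmxA B D) -/U (mulmxK Uu).
have e2 : X *m (B *m D) = D ^t* *m invmx U *m D.
  by rewrite /X !mulmxA -(mulmxA _ (B ^t*) B) -/V (mulmxKV Vu).
split.
- by rewrite e1 !mulmxA -(mulmxA _ (B ^t*) B) -/V (mulmxKV Vu).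
- by rewrite e2 /X !mulmxA -(mulmxA _ D (D ^t*)) -/U (mulmxKV Uu).
- by rewrite e1 !trmxC_mul trmxCK trmxC_inv Vh mulmxA.
- by rewrite e2 !trmxC_mul trmxCK trmxC_inv Uh mulmxA.
Qed.

Lemma mpinvP p q (A : 'M[C]_(p, q)) : is_mpinv A (mpinv A).
Proof.
suff [B AB] : exists B, is_mpinv A B by apply: (xgetPex 0); exists B.
have freeC : row_free ((col_base A) ^t*).
  by rewrite /row_free mxrank_map mxrank_tr -/(row_full _) col_base_full.
have := full_rank_mpinv freeC (row_base_free A).
by rewrite mulmx_base; eexists; eassumption.
Qed.

Definition Emx n m : 'M[C]_(n, n + m) := row_mx 1%:M 0.

(* L_1 - L_2 L_3^+ L_2^* for L = [L_1, L_2; L_2^*, L_3] *)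
Definition gschur n m (L : 'M[C]_(n + m)) : 'M[C]_n :=
  ulsubmx L - ursubmx L *m mpinv (drsubmx L) *m (ursubmx L) ^t*.

Definition gain n m (L : 'M[C]_(n + m)) : 'M[C]_(m, n) :=
  - (mpinv (drsubmx L) *m (ursubmx L) ^t*).

Definition gain_lift n m (K : 'M[C]_(m, n)) (Y : 'M[C]_n) : 'M[C]_(n + m) :=
  block_mx Y (Y *m K ^t*) (K *m Y) (K *m Y *m K ^t*).

End Matrices.

(* * Matrix-valued functions of a real variable
   Limits, derivatives and integrals are taken on the real and imaginary parts
   of the entries. *)

Section MatrixFunctions.
Variables (R : realType) (p q : nat).
Local Notation C := R[i].
Local Notation mxfun := (R -> 'M[C]_(p, q)).
Local Notation mu := (@lebesgue_measure R).

Definition re_ent (f : mxfun) i j (t : R) : R := complex.Re (f t i j).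
Definition im_ent (f : mxfun) i j (t : R) : R := complex.Im (f t i j).

Definition entrywise (Q : (R -> R) -> Prop) (f : mxfun) : Prop :=
  forall i j, Q (re_ent f i j) /\ Q (im_ent f i j).

Definition mx_cvg (f : mxfun) (G : set_system R) (L : 'M[C]_(p, q)) : Prop :=
  forall i j, re_ent f i j x @[x --> G] --> complex.Re (L i j) /\
              im_ent f i j x @[x --> G] --> complex.Im (L i j).

Definition mx_is_derive (f : mxfun) (t : R) (D : 'M[C]_(p, q)) : Prop :=
  forall i j, is_derive t 1 (re_ent f i j) (complex.Re (D i j)) /\
              is_derive t 1 (im_ent f i j) (complex.Im (D i j)).

Definition mx_derive (f : mxfun) (t : R) : 'M[C]_(p, q) :=
  \matrix_(i, j) (derive1 (re_ent f i j) t +i* derive1 (im_ent f i j) t)%C.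

Definition mx_rlim (f : mxfun) (t : R) : 'M[C]_(p, q) :=
  \matrix_(i, j) (lim (re_ent f i j x @[x --> t^'+]) +i*
                  lim (im_ent f i j x @[x --> t^'+]))%C.

Definition mx_integral (a b : R) (f : mxfun) : 'M[C]_(p, q) :=
  \matrix_(i, j) ((\int[mu]_(x in `[a, b]) re_ent f i j x) +i*
                  (\int[mu]_(x in `[a, b]) im_ent f i j x))%C.

Definition mx_integrable (D : set R) (f : mxfun) : Prop :=
  entrywise (fun g => mu.-integrable D (EFin \o g)) f.

Definition mx_continuous_on (D : set R) (f : mxfun) : Prop :=
  entrywise (fun g => {within D, continuous g}) f.

Definition mx_C1 (f : mxfun) : Prop :=
  entrywise (fun g => (forall x, derivable g x 1) /\ continuous (derive1 g)) f.

End MatrixFunctions.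

(* * Impulsive systems *)

(* [jump k] is t_k (k >= 1; the value at 0 is irrelevant) and [njumps] is N_T;
   [Fadj t] and [Jadj k] are the adjoints of [F t] and [J k]; [Z] and [Zj] are
   the weights Z(t) and Z_k. *)
Record impulsive_data (R : realType) (n m : nat) := ImpulsiveData {
  t0 : R;
  horizon : R;
  jump : nat -> R;
  njumps : nat;
  F : R -> 'M[R[i]]_(n + m) -> 'M[R[i]]_n;
  J : nat -> 'M[R[i]]_(n + m) -> 'M[R[i]]_n;
  Fadj : R -> 'M[R[i]]_n -> 'M[R[i]]_(n + m);
  Jadj : nat -> 'M[R[i]]_n -> 'M[R[i]]_(n + m);
  Z : R -> 'M[R[i]]_(n + m);
  Zj : nat -> 'M[R[i]]_(n + m) }.

Section Systems.
Variables (R : realType) (n m : nat) (S : impulsive_data R n m).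
Local Notation C := R[i].
Local Notation mu := (@lebesgue_measure R).
Local Notation t0 := (t0 S).
Local Notation E := (Emx R n m).

Definition t1 : R := t0 + horizon S.

Definition is_jump_index (k : nat) : Prop := (0 < k <= njumps S)%N.

Definition is_jump_time (t : R) : Prop :=
  exists2 k, is_jump_index k & t = jump S k.

Definition hermitian_linear p q (f : 'M[C]_p -> 'M[C]_q) : Prop :=
  [/\ forall A, A \is hermsymmx -> f A \is hermsymmx,
      forall A B, A \is hermsymmx -> B \is hermsymmx -> f (A + B) = f A + f B
    & forall (a : R) A, A \is hermsymmx -> f (a%:C *: A) = a%:C *: f A].

Definition hermitian_adjoint p q (f : 'M[C]_p -> 'M[C]_q)
    (g : 'M[C]_q -> 'M[C]_p) : Prop :=
  (forall P, P \is hermsymmx -> g P \is hermsymmx) /\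
  (forall P X, P \is hermsymmx -> X \is hermsymmx ->
     mxip P (f X) = mxip (g P) X).

(* Invariance of the cone under the flow: the second moment of the state stays
   positive semidefinite, whatever the gain K and the covariance W >= 0 of the
   part of the input that is not a feedback of the state.  Every X >= 0 is of
   the form [gain_lift K Y + diag(0, W)]. *)
Definition flow_invariant : Prop :=
  forall (a b : R) (K : R -> 'M[C]_(m, n)) (W : R -> 'M[C]_m)
         (Y : R -> 'M[C]_n),
  t0 <= a -> a < b -> b <= t1 ->
  mx_continuous_on `[a, b] K -> mx_continuous_on `[a, b] W ->
  mx_continuous_on `[a, b] Y ->
  (forall t, t \in `[a, b] -> psdmx (W t)) ->
  (forall t, t \in `[a, b] -> Y t \is hermsymmx) ->
  (forall t, t \in `]a, b[ ->
     mx_is_derive Y t (F S t (gain_lift (K t) (Y t) + block_mx 0 0 0 (W t)))) ->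
  psdmx (Y a) -> forall t, t \in `[a, b] -> psdmx (Y t).

Record impulsive_system : Prop := {
  horizon_gt0 : 0 < horizon S;
  jump_increasing : forall k l : nat,
    (0 < k)%N -> (k < l)%N -> jump S k < jump S l;
  jump_unbounded : jump S k @[k --> \oo] --> +oo;
  jump_inside : forall k : nat, (0 < k)%N ->
    (t0 < jump S k < t1) = (k <= njumps S)%N;
  F_linear : forall t, t \in `[t0, t1] -> hermitian_linear (F S t);
  J_linear : forall k, (0 < k)%N -> hermitian_linear (J S k);
  F_continuous : forall X, X \is hermsymmx ->
    mx_continuous_on `[t0, t1] (fun t => F S t X);
  F_invariant : flow_invariant;
  J_invariant : forall k X, (0 < k)%N -> psdmx X -> psdmx (J S k X);
  F_adjoint : forall t, t \in `[t0, t1] ->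
    hermitian_adjoint (F S t) (Fadj S t);
  J_adjoint : forall k, (0 < k)%N -> hermitian_adjoint (J S k) (Jadj S k);
  Z_psd : forall t, t \in `[t0, t1] -> psdmx (Z S t);
  Zj_psd : forall k, (0 < k)%N -> psdmx (Zj S k) }.

(* Conventions at jumps: all time functions are left-continuous in their state
   component, so the value at t_k is the one at t_k^-.  In particular [X (jump k)]
   is X(t_k^-); its blocks X_2, X_3 are free there as well, and are not limits
   of the values of X_2, X_3 on the preceding flow interval. *)

(* dY/dt = G between jumps, in the sense of Caratheodory: on each flow interval
   Y is absolutely continuous (the integral of an integrable function g), and
   dY/dt = g = G almost everywhere.  For s <= t without jump time in [s, t[, the
   case t = t_k gives the left-continuity of Y at t_k. *)
Definition flows (Y G : R -> 'M[C]_n) : Prop :=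
  exists g : R -> 'M[C]_n,
  [/\ mx_integrable `[t0, t1] g,
      forall s t, t0 <= s -> s <= t -> t <= t1 ->
        (forall r, s <= r < t -> ~ is_jump_time r) ->
        Y t = Y s + mx_integral s t g
    & {ae mu, forall t, `[t0, t1]%classic t ->
         mx_is_derive Y t (g t) /\ g t = G t}].

Definition running_cost (X : R -> 'M[C]_(n + m)) (t : R) : R :=
  complex.Re (mxip (Z S t) (X t)).

(* The third clause is Lebesgue measurability of the integrand of the cost
   (measurable functions of the library are Borel). *)
Record trajectory (X10 : 'M[C]_n) (X : R -> 'M[C]_(n + m)) : Prop := {
  traj_psd : forall t, t \in `[t0, t1] -> psdmx (X t);
  traj_init : E *m X t0 *m E ^t* = X10;
  traj_measurable : exists2 h : R -> R, measurable_fun `[t0, t1] h &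
    {ae mu, forall t, `[t0, t1]%classic t -> running_cost X t = h t};
  traj_flow : flows (fun t => E *m X t *m E ^t*) (fun t => F S t (X t));
  traj_jump : forall k, is_jump_index k ->
    mx_cvg (fun t => E *m X t *m E ^t*) (jump S k)^'+
           (J S k (X (jump S k))) }.

Definition cost (X : R -> 'M[C]_(n + m)) : \bar R :=
  (\int[mu]_(t in `[t0, t1]) (running_cost X t)%:E +
   (\sum_(1 <= k < (njumps S).+1)
      complex.Re (mxip (Zj S k) (X (jump S k))))%:E)%E.

Definition steering_value (X10 X1f : 'M[C]_n) : \bar R :=
  ereal_inf [set cost X | X in
    [set X | trajectory X10 X /\ E *m X t1 *m E ^t* = X1f]].

Definition terminal_cost (M : 'M[C]_n) (X : R -> 'M[C]_(n + m)) : \bar R :=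
  (cost X + (complex.Re (mxip M (E *m X t1 *m E ^t*)))%:E)%E.

Definition unconstrained_optimal (X10 M : 'M[C]_n) (X : R -> 'M[C]_(n + m)) :
    Prop :=
  trajectory X10 X /\
  forall X', trajectory X10 X' -> (terminal_cost M X <= terminal_cost M X')%E.

(* * Impulsive generalized Riccati equation *)

Definition CZ (P : R -> 'M[C]_n) (t : R) : 'M[C]_(n + m) :=
  E ^t* *m mx_derive P t *m E + Fadj S t (P t) + Z S t.

Definition DZ (k : nat) (Pplus Pminus : 'M[C]_n) : 'M[C]_(n + m) :=
  Jadj S k Pplus - E ^t* *m Pminus *m E + Zj S k.

(* [D_Z(k, P(t_k^+), P(t_k^-))] *)
Definition DZ_at (P : R -> 'M[C]_n) (k : nat) : 'M[C]_(n + m) :=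
  DZ k (mx_rlim P (jump S k)) (P (jump S k)).

(* Between two consecutive points of the finite list s, P is the restriction of
   a C1 function on the line, i.e. is C1 up to the end points. *)
Definition piecewise_C1 (P : R -> 'M[C]_n) : Prop :=
  (exists s : seq R, forall a b, t0 <= a -> a < b -> b <= t1 ->
     (forall x, x \in s -> ~ (a < x < b)) ->
     exists2 Q : R -> 'M[C]_n, mx_C1 Q &
       forall x, a < x < b -> P x = Q x) /\
  (forall t, t0 < t <= t1 -> mx_cvg P t^'- (P t)) /\
  (forall t, t0 <= t < t1 -> ~ is_jump_time t -> mx_cvg P t^'+ (P t)).

Definition riccati_lmi (L : 'M[C]_(n + m)) : Prop :=
  psdmx L /\ gschur L = 0.

Definition riccati_solution (P : R -> 'M[C]_n) : Prop :=
  [/\ forall t, t \in `[t0, t1] -> P t \is hermsymmx,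
      piecewise_C1 P,
      {ae mu, forall t, `[t0, t1]%classic t -> riccati_lmi (CZ P t)}
    & forall k, is_jump_index k -> riccati_lmi (DZ_at P k)].

Definition flow_gain (P : R -> 'M[C]_n) (t : R) : 'M[C]_(m, n) :=
  gain (CZ P t).

Definition jump_gain (P : R -> 'M[C]_n) (k : nat) : 'M[C]_(m, n) :=
  gain (DZ_at P k).

Definition Acl (P : R -> 'M[C]_n) (t : R) (Y : 'M[C]_n) : 'M[C]_n :=
  F S t (gain_lift (flow_gain P t) Y).

Definition Bcl (P : R -> 'M[C]_n) (k : nat) (Y : 'M[C]_n) : 'M[C]_n :=
  J S k (gain_lift (jump_gain P k) Y).

(* [X] is X^*(.; M), for P = P(.; M) *)
Record optimal_closed_loop (X10 M : 'M[C]_n) (P : R -> 'M[C]_n)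
    (X : R -> 'M[C]_(n + m)) : Prop := {
  ocl_riccati : riccati_solution P;
  ocl_terminal : P t1 = M;
  ocl_optimal : unconstrained_optimal X10 M X;
  ocl_flow : forall t, t \in `[t0, t1] -> ~ is_jump_time t ->
    dlsubmx (X t) = flow_gain P t *m ulsubmx (X t) /\
    drsubmx (X t) = flow_gain P t *m ulsubmx (X t) *m (flow_gain P t) ^t*;
  ocl_jump : forall k, is_jump_index k ->
    dlsubmx (X (jump S k)) = jump_gain P k *m ulsubmx (X (jump S k)) /\
    drsubmx (X (jump S k)) =
      jump_gain P k *m ulsubmx (X (jump S k)) *m (jump_gain P k) ^t* }.

Definition steers (X1f : 'M[C]_n) (X : R -> 'M[C]_(n + m)) : Prop :=
  E *m X t1 *m E ^t* = X1f.

Record moment_solution (X10 : 'M[C]_n) (P Sigma : R -> 'M[C]_n) : Prop := {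
  moment_psd : forall t, t \in `[t0, t1] -> psdmx (Sigma t);
  moment_init : Sigma t0 = X10;
  moment_flow : flows Sigma (fun t => Acl P t (Sigma t));
  moment_jump : forall k, is_jump_index k ->
    mx_cvg Sigma (jump S k)^'+ (Bcl P k (Sigma (jump S k))) }.

(* Forward integration from X10 has at most one outcome.  This is automatic when
   the gain is, say, bounded, but can fail when (C_Z)_3 changes rank: with
   n = m = 1, F(X) = - X_2 - X_2^*, Z(t) = [1, t; t, t^2] and no jumps, P = 0
   solves the Riccati equation, K(t) = - 1 / t for t > 0, and Sigma(t) = c t^2
   is a solution from 0 at time 0 for every c >= 0. *)
Definition moment_determinate (X10 : 'M[C]_n) (P : R -> 'M[C]_n) : Prop :=
  forall Sigma Sigma', moment_solution X10 P Sigma ->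
    moment_solution X10 P Sigma' ->
    forall t, t \in `[t0, t1] -> Sigma t = Sigma' t.

Record tpbvp (X10 X1f : 'M[C]_n) (P Sigma : R -> 'M[C]_n) (M : 'M[C]_n) :
    Prop := {
  tpbvp_psd : psdmx M;
  tpbvp_riccati : riccati_solution P;
  tpbvp_moment : moment_solution X10 P Sigma;
  tpbvp_terminal : P t1 = M;
  tpbvp_target : Sigma t1 = X1f }.

End Systems.

(* Main.v *)
Require Import Defs.
From mathcomp Require Import all_boot all_order all_algebra complex.
From mathcomp Require Import sesquilinear spectral ring.
From mathcomp Require Import all_classical all_reals all_analysis.
From mathcomp Require Import measurable_realfun.
Set Implicit Arguments.
Unset Strict Implicit.
Unset Printing Implicit Defensive.
Import Order.TTheory GRing.Theory Num.Theory.
Import numFieldNormedType.Exports.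
Local Open Scope classical_set_scope.
Local Open Scope complex_scope.
Local Open Scope sesquilinear_scope.
Local Open Scope ring_scope.

(** All three claims are read off one energy balance.  Let P solve the Riccati
   equation and let X be a trajectory with state block X_1.  Adjointness of F
   and J gives
     d/dt <P, X_1> = <P', X_1> + <P, F(X)> = <C_Z, X> - <Z, X>
   along the flow and
     <P(t_k+), X_1(t_k+)> - <P(t_k-), X_1(t_k-)> = <D_Z, X> - <Z_k, X>
   at a jump.  Summing up over [t_0, t_f] with t_f = t_0 + T,
     int <Z, X> + sum <Z_k, X> + <P(t_f), X_1(t_f)>
       = <P(t_0), X_1(t_0)> + int <C_Z, X> + sum <D_Z, X>
   ([energy_balance_dynamics]).  Since C_Z and D_Z are positive semidefinite,
   and since two positive semidefinite matrices have a nonnegative inner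
   product, the cost with terminal weight P(t_f) is at least
   <P(t_0), X_1(t_0)> for every trajectory ([verification]).  If X is in
   feedback form for the Riccati gains, X = V X_1 V^* with V = [I; K], then
   <L, X> = <V^* L V, X_1>, and V^* L V is the generalized Schur complement of
   L, which vanishes ([riccati_gain_orth]): the bound is attained
   ([feedback_trajectory]).

   So every solution Sigma of the moment equations is the state of an optimal
   closed loop ([moment_optimal]), and conversely the state of an optimal closed
   loop solves the moment equations ([optimal_moment]); under this
   correspondence the steering condition is Sigma(t_f) = X_1^f.  On the
   trajectories with X_1(t_f) = X_1^f the terminal term is a constant, so the
   same bound and the same closed loop give the value of the steering problem
   ([steering_value_tpbvp]).

   Two points need care.  The state is only absolutely continuous, so the balance
   rests on an integration by parts between a C1 function and an indefinite
   Lebesgue integral ([ac_by_parts]), which is Fubini's theorem on a triangle.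
   And nothing is known about the measurability in time of the gain, which
   involves a pseudoinverse: the running cost of a closed loop is measurable up
   to a null set because the balance identifies it with the derivative of
   - <P, X_1>.  Integrals of such functions are compared through the simple
   functions below them ([ge0_ae_le_integral_nomeas]). *)

(** * Complex matrices *)

Section Matrices.
Variable R : realType.
Local Notation C := R[i].

Lemma hermP p (A : 'M[C]_p) : A \is hermsymmx <-> A ^t* = A.
Proof.
rewrite qualifE /= -subr_eq0 expr0 scale1r subr_eq0 eq_sym.
split; [by move=> /eqP|by move=> /eqP].
Qed.

Lemma trmxCN p q (A : 'M[C]_(p, q)) : (- A) ^t* = - A ^t*.
Proof. by rewrite linearN /= map_mxN. Qed.

Lemma mpinv_unique p q (A : 'M[C]_(p, q)) (B B' : 'M[C]_(q, p)) :
  is_mpinv A B -> is_mpinv A B' -> B = B'.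
Proof.
move=> [a1 a2 a3 a4] [b1 b2 b3 b4].
have eAB : A *m B = A *m B'.
  by rewrite -[LHS]a3 -[in LHS]b1 -(mulmxA _ A B) trmxC_mul a3 b3 mulmxA a1.
have eBA : B *m A = B' *m A.
  by rewrite -[LHS]a4 -[in LHS]b1 -(mulmxA A B' A) (mulmxA B A) trmxC_mul a4 b4
             -!mulmxA (mulmxA A) a1.
by rewrite -[LHS]a2 eBA -mulmxA eAB mulmxA b2.
Qed.

Lemma is_mpinv_trmxC p q (A : 'M[C]_(p, q)) (B : 'M[C]_(q, p)) :
  is_mpinv A B -> is_mpinv (A ^t*) (B ^t*).
Proof.
by move=> [a1 a2 a3 a4]; split; rewrite -!trmxC_mul ?mulmxA ?a1 ?a2 ?a3 ?a4.
Qed.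

(** By uniqueness, since the adjoint of a pseudoinverse is a pseudoinverse of the
   adjoint. *)
Lemma mpinv_herm p (A : 'M[C]_p) : A ^t* = A -> (mpinv A) ^t* = mpinv A.
Proof.
move=> hA; apply: (mpinv_unique _ (mpinvP A)).
by rewrite -[X in is_mpinv X _]hA; apply/is_mpinv_trmxC/mpinvP.
Qed.

(** The real inner product on complex matrices; it agrees with [mxip] on
   Hermitian matrices, where the latter is real. *)
Definition rip p q (A B : 'M[C]_(p, q)) : R := complex.Re (mxip A B).

Lemma ReM_conj (x y : C) :
  complex.Re (x * y^*) =
  complex.Re x * complex.Re y + complex.Im x * complex.Im y.
Proof. by case: x y => [a b] [c d] /=; rewrite mulrN opprK. Qed.

Lemma rip_sum p q (A B : 'M[C]_(p, q)) : rip A B = \sum_i \sum_j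
  (complex.Re (A i j) * complex.Re (B i j) +
   complex.Im (A i j) * complex.Im (B i j)).
Proof.
rewrite /rip /mxip /mxtrace raddf_sum; apply: eq_bigr => i _.
rewrite mxE raddf_sum; apply: eq_bigr => j _.
by rewrite !mxE -ReM_conj.
Qed.

Lemma mxipDl p q (A A' B : 'M[C]_(p, q)) :
  mxip (A + A') B = mxip A B + mxip A' B.
Proof. by rewrite /mxip mulmxDl linearD. Qed.

Lemma mxipNl p q (A B : 'M[C]_(p, q)) : mxip (- A) B = - mxip A B.
Proof. by rewrite /mxip mulNmx linearN. Qed.

Lemma ripDl p q (A A' B : 'M[C]_(p, q)) : rip (A + A') B = rip A B + rip A' B.
Proof. by rewrite /rip mxipDl raddfD. Qed.

Lemma ripNl p q (A B : 'M[C]_(p, q)) : rip (- A) B = - rip A B.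
Proof. by rewrite /rip mxipNl raddfN. Qed.

Lemma mxip_compress p q (V : 'M[C]_(p, q)) (A : 'M[C]_p) (X : 'M[C]_q) :
  mxip (V ^t* *m A *m V) X = mxip A (V *m X *m V ^t*).
Proof. by rewrite /mxip !trmxC_mul trmxCK -!mulmxA mxtrace_mulC !mulmxA. Qed.

Lemma psdmx_congr p q (V : 'M[C]_(p, q)) (X : 'M[C]_q) :
  psdmx X -> psdmx (V *m X *m V ^t*).
Proof.
move=> [/hermP hX X0]; split.
  by apply/hermP; rewrite !trmxC_mul hX trmxCK mulmxA.
by move=> v; have := X0 (V ^t* *m v); rewrite trmxC_mul trmxCK !mulmxA.
Qed.

Lemma psdmx_diag_ge0 p (X : 'M[C]_p) i : psdmx X -> 0 <= X i i.
Proof.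
move=> [_ /(_ (delta_mx i 0))]; congr (_ <= _).
rewrite trmx_delta map_delta_mx -rowE -colE.
by rewrite !mxE.
Qed.

(** In an eigenbasis of L the inner product is the sum of the eigenvalues of L
   weighted by the diagonal of X, and both are nonnegative. *)
Lemma mxip_psd_ge0 p (L X : 'M[C]_p) : psdmx L -> psdmx X -> 0 <= mxip L X.
Proof.
move=> Lpsd Xpsd; have [hL _] := Lpsd; have [/hermP hX _] := Xpsd.
have U := spectral_unitarymx L.
have := orthomx_spectralP (hermitian_normalmx hL).
set P := spectralmx L in U *; set D := diag_mx _ => LE.
have {}LE : L = P ^t* *m D *m P by rewrite [LHS]LE invmx_unitary.
have Dpsd : psdmx D.
  have -> : D = P *m L *m P ^t*.
    rewrite LE !mulmxA; have /unitarymxP -> := U.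
    by rewrite mul1mx mulmxtVK.
  exact: psdmx_congr.
rewrite LE mxip_compress; set Y := _ *m X *m _.
have Ypsd : psdmx Y by exact: psdmx_congr.
have [/hermP hY _] := Ypsd.
rewrite /mxip hY /mxtrace sumr_ge0 // => i _.
rewrite mul_diag_mx mxE mulr_ge0 //.
  by have := psdmx_diag_ge0 i Dpsd; rewrite mxE eqxx.
exact: psdmx_diag_ge0.
Qed.

Lemma rip_psd_ge0 p (L X : 'M[C]_p) : psdmx L -> psdmx X -> 0 <= rip L X.
Proof. by move=> Lp Xp; have := mxip_psd_ge0 Lp Xp; rewrite lecE => /andP[]. Qed.

Lemma gain_liftE n m (K : 'M[C]_(m, n)) (Y : 'M[C]_n) :
  gain_lift K Y = col_mx 1%:M K *m Y *m (col_mx 1%:M K) ^t*.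
Proof.
rewrite tr_col_mx map_row_mx trmx1 map_mx1 mul_col_mx mul1mx.
by rewrite mul_col_row !mulmx1.
Qed.

Lemma psdmx_gain_lift n m (K : 'M[C]_(m, n)) (Y : 'M[C]_n) :
  psdmx Y -> psdmx (gain_lift K Y).
Proof. by rewrite gain_liftE; exact: psdmx_congr. Qed.

Lemma hermsym_blocks n m (L : 'M[C]_(n + m)) : L ^t* = L ->
  [/\ (ulsubmx L) ^t* = ulsubmx L, (drsubmx L) ^t* = drsubmx L,
      (dlsubmx L) ^t* = ursubmx L & (ursubmx L) ^t* = dlsubmx L].
Proof.
move=> hL; move: hL; rewrite -{1 2}[L]submxK tr_block_mx map_block_mx.
by move=> /eq_block_mx[].
Qed.

Lemma ulsubmx_gain_lift n m (K : 'M[C]_(m, n)) Y : ulsubmx (gain_lift K Y) = Y.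
Proof. exact: block_mxKul. Qed.

Lemma EmxE n m (X : 'M[C]_(n + m)) :
  Emx R n m *m X *m (Emx R n m) ^t* = ulsubmx X.
Proof.
rewrite -{1}[X]submxK /Emx mul_row_block !mul1mx !mul0mx !addr0.
rewrite tr_row_mx map_col_mx mul_row_col trmx1 map_mx1 mulmx1 trmx0 map_mx0.
by rewrite mulmx0 addr0.
Qed.

Lemma congr_col_mx n m (K : 'M[C]_(m, n)) (L : 'M[C]_(n + m)) :
  (col_mx 1%:M K) ^t* *m L *m col_mx 1%:M K =
  ulsubmx L + ursubmx L *m K + K ^t* *m (dlsubmx L + drsubmx L *m K).
Proof.
rewrite -{1}[L]submxK tr_col_mx map_row_mx trmx1 map_mx1 mul_row_block.
rewrite mul_row_col !mul1mx mulmx1 mulmxDl mulmxDr !mulmxA.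
by rewrite -!addrA; congr (_ + _); rewrite addrCA.
Qed.

(** <L, V Y V^*> = <V^* L V, Y> for V = [I; K], and completing the square shows
   that V^* L V is the generalized Schur complement of L when
   K = - L_3^+ L_2^*.  This is why the Riccati gains are optimal. *)
Lemma riccati_gain_orth n m (L : 'M[C]_(n + m)) (Y : 'M[C]_n) :
  riccati_lmi L -> mxip L (gain_lift (gain L) Y) = 0.
Proof.
move=> [[/hermP hL _] L0].
have [_ h3 _ h2] := hermsym_blocks hL; have hM := mpinv_herm h3.
have [_ M2 _ _] := mpinvP (drsubmx L).
rewrite gain_liftE -mxip_compress congr_col_mx /mxip.
suff -> : ulsubmx L + ursubmx L *m gain L + (gain L) ^t* *m
    (dlsubmx L + drsubmx L *m gain L) = 0 by rewrite mul0mx linear0.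
move: L0; rewrite /gschur /gain -h2 !trmxCN !trmxC_mul trmxCK hM.
rewrite !mulmxN !mulNmx !mulmxDr !mulmxN !mulmxA.
have -> : ursubmx L *m mpinv (drsubmx L) *m drsubmx L *m mpinv (drsubmx L) =
          ursubmx L *m mpinv (drsubmx L) by rewrite -!mulmxA (mulmxA (mpinv _)) M2.
by move=> e; rewrite e !subrr.
Qed.

Lemma gain_liftP n m (K : 'M[C]_(m, n)) (X : 'M[C]_(n + m)) :
  X \is hermsymmx -> dlsubmx X = K *m ulsubmx X ->
  drsubmx X = K *m ulsubmx X *m K ^t* -> X = gain_lift K (ulsubmx X).
Proof.
move=> /hermP/hermsym_blocks[ul _ ur _] dl dr.
by rewrite -[LHS]submxK /gain_lift -dr -dl -ur dl trmxC_mul ul.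
Qed.

End Matrices.

(** * Integrals of real functions *)

Section NonMeasurable.
Local Open Scope ereal_scope.
Context d (T : measurableType d) (R : realType).
Variable mu : {measure set T -> \bar R}.
Import HBNNSimple.

(** Here f and g are arbitrary nonnegative functions.  The integral of such a
   function is the supremum of the integrals of the simple functions below it,
   and a simple function below f, once set to 0 on the exceptional null set, is
   below g and keeps its integral. *)
Lemma ge0_ae_le_integral_nomeas (D : set T) (f g : T -> \bar R) :
  (forall x, D x -> 0 <= f x) -> (forall x, D x -> 0 <= g x) ->
  {ae mu, forall x, D x -> f x <= g x} ->
  \int[mu]_(x in D) f x <= \int[mu]_(x in D) g x.
Proof.
move=> f0 g0 [N [mN N0 fgN]]; rewrite !ge0_integralE //.
apply: ge_ereal_sup => _ [h hf <-].
apply: le_ereal_sup_tmp; exists (sintegral mu (h \_ (~` N))).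
  rewrite (mrestrict h (measurableC mN)).
  exists (proj_nnsfun h (measurableC mN)) => //= x.
  rewrite -[(h x * _)%R]/(proj_nnsfun h (measurableC mN) x) -mrestrict.
  rewrite patchE; case: ifPn => [|_]; last first.
    by rewrite patchE; case: ifPn => // /set_mem/g0.
  rewrite inE /= => Nx; apply: le_trans (hf x) _; rewrite !patchE.
  case: ifPn => // /set_mem Dx; apply: contrapT => fg; apply: Nx; apply: fgN.
  by move=> /(_ Dx).
rewrite -integral_nnsfun; last exact: measurableC.
rewrite -integralT_nnsfun -setTD -ge0_negligible_integral //.
- exact/measurable_EFinP.
- by move=> x _; rewrite lee_fin.
Qed.

End NonMeasurable.

Section IntegralIs.
Variable R : realType.
Local Notation mu := (@lebesgue_measure R).

Lemma EFin_Rintegral (D : set R) (f : R -> R) : measurable D ->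
  mu.-integrable D (EFin \o f) ->
  (\int[mu]_(x in D) (f x)%:E)%E = (\int[mu]_(x in D) f x)%:E.
Proof.
by move=> mD If; rewrite /Rintegral fineK //; exact: integrable_fin_num.
Qed.

Lemma integrableD_EFin (D : set R) (f g : R -> R) : measurable D ->
  mu.-integrable D (EFin \o f) -> mu.-integrable D (EFin \o g) ->
  mu.-integrable D (EFin \o (fun x => f x + g x)).
Proof.
move=> mD If Ig; rewrite (_ : EFin \o _ = (EFin \o f) \+ (EFin \o g))%E //.
exact: integrableD.
Qed.

Lemma integrableZ_EFin (D : set R) (f : R -> R) k : measurable D ->
  mu.-integrable D (EFin \o f) ->
  mu.-integrable D (EFin \o (fun x => k * f x)).
Proof.
move=> mD If; rewrite (_ : EFin \o _ = (fun x => k%:E * (EFin \o f) x)%E) //.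
exact: integrableZl.
Qed.

Lemma ae_imp (P Q : R -> Prop) : (forall x, P x -> Q x) ->
  {ae mu, forall x, P x} -> {ae mu, forall x, Q x}.
Proof.
by move=> PQ [A [mA A0 PA]]; exists A; split => // x nQ; apply: PA => /PQ.
Qed.

Lemma ae_and (P Q : R -> Prop) : {ae mu, forall x, P x} ->
  {ae mu, forall x, Q x} -> {ae mu, forall x, P x /\ Q x}.
Proof.
move=> [A [mA A0 PA]] [B [mB B0 QB]]; exists (A `|` B); split.
- exact: measurableU.
- exact: null_set_setU.
- by move=> x /= /not_andP[nP|nQ]; [left; apply: PA|right; apply: QB].
Qed.

Lemma ge0_ae_le_Rintegral (D : set R) (w f : R -> R) : measurable D ->
  mu.-integrable D (EFin \o w) -> (forall x, D x -> 0 <= f x) ->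
  {ae mu, forall x, D x -> w x <= f x} ->
  ((\int[mu]_(x in D) w x)%:E <= \int[mu]_(x in D) (f x)%:E)%E.
Proof.
move=> mD Iw f0 wf; rewrite /Rintegral fineK; last exact: integrable_fin_num.
have mw : measurable_fun D w.
  by apply/measurable_EFinP; exact: measurable_int Iw.
apply: (@le_trans _ _ (\int[mu]_(x in D) (Num.max (w x) 0)%:E)%E).
  apply: le_integral => //.
    apply: le_integrable Iw => //.
      by apply/measurable_EFinP; apply: measurable_maxr.
    move=> x Dx /=; rewrite lee_fin.
    by case: (leP (w x) 0) => _; rewrite ?normr0.
  by move=> x _ /=; rewrite lee_fin le_max lexx.
apply: ge0_ae_le_integral_nomeas => //.
- by move=> x Dx; rewrite lee_fin le_max lexx orbT.
apply: ae_imp wf => x wf Dx; rewrite lee_fin ge_max wf //=.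
exact: f0.
Qed.

Lemma ge0_ae_eq_Rintegral (D : set R) (w f : R -> R) : measurable D ->
  mu.-integrable D (EFin \o w) -> (forall x, D x -> 0 <= f x) ->
  {ae mu, forall x, D x -> f x = w x} ->
  (\int[mu]_(x in D) (f x)%:E)%E = (\int[mu]_(x in D) w x)%:E.
Proof.
move=> mD Iw f0 wf; apply/eqP; rewrite eq_le; apply/andP; split; last first.
  by apply: ge0_ae_le_Rintegral => //; apply: ae_imp wf => x fw /fw ->.
rewrite /Rintegral fineK; last exact: integrable_fin_num.
have mw : measurable_fun D w.
  by apply/measurable_EFinP; exact: measurable_int Iw.
apply: (@le_trans _ _ (\int[mu]_(x in D) (Num.max (w x) 0)%:E)%E).
  apply: ge0_ae_le_integral_nomeas => //.
  - by move=> x Dx; rewrite lee_fin le_max lexx orbT.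
  - apply: ae_imp wf => x wf Dx; rewrite lee_fin -wf //.
    by rewrite le_max lexx.
rewrite le_eqVlt; apply/orP; left; apply/eqP; apply: ae_eq_integral => //.
- by apply/measurable_EFinP; apply: measurable_maxr.
- exact/measurable_EFinP.
- by apply: ae_imp wf => x wf Dx /=; rewrite -wf // max_l // f0.
Qed.

(** Integrability is kept together with the value, because [Rintegral] is total
   and says nothing about f when f is not integrable. *)
Definition integral_is (D : set R) (f : R -> R) (v : R) :=
  mu.-integrable D (EFin \o f) /\ \int[mu]_(x in D) f x = v.

Lemma integral_isD D f g v w : measurable D ->
  integral_is D f v -> integral_is D g w ->
  integral_is D (fun x => f x + g x) (v + w).
Proof.
move=> mD [If <-] [Ig <-]; split; last by rewrite RintegralD.
exact: integrableD_EFin.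
Qed.

Lemma integral_is_sum (I : Type) (s : seq I) D f v : measurable D ->
  (forall i : I, integral_is D (f i) (v i)) ->
  integral_is D (fun x => \sum_(i <- s) f i x) (\sum_(i <- s) v i).
Proof.
move=> mD H; elim: s => [|i s IH].
  rewrite big_nil (_ : (fun _ => _) = cst 0); last first.
    by apply/funext => x; rewrite big_nil.
  split; last by rewrite Rintegral_cst // mul0r.
  exact: integrable0.
rewrite big_cons (_ : (fun _ => _) = fun x => f i x + \sum_(j <- s) f j x).
  exact: integral_isD.
by apply/funext => x; rewrite big_cons.
Qed.

(** Changing a function at the end points of an interval, where the formulas for
   derivatives are only one-sided, affects neither measurability nor the
   integral. *)
Lemma integral_is_eqoo a b f g v :
  (forall x, a < x < b -> f x = g x) ->
  integral_is `[a, b] f v -> integral_is `[a, b] g v.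
Proof.
move=> fg [If <-].
have fgoo : {in `]a, b[, f =1 g} by move=> x; rewrite in_itv /=; exact: fg.
have mf : measurable_fun `[a, b] f.
  by apply/measurable_EFinP; exact: measurable_int If.
have mfo : measurable_fun `]a, b[ f.
  by apply: measurable_funS mf => //; exact: subset_itv_oo_cc.
have mgo : measurable_fun `]a, b[ g.
  by apply: eq_measurable_fun mfo => x; rewrite inE; exact: fgoo.
have mg : measurable_fun `[a, b] g.
  by apply/measurable_fun_itv_obnd_cbndP/measurable_fun_itv_bndo_bndcP.
split; last first.
  rewrite /Rintegral; congr fine; apply: eq_integral_itv_bounded => //.
  by move=> x /fgoo.
apply/integrableP; split; first exact/measurable_EFinP.
have /integrableP[_] := If; congr (_ < _)%E.
apply: eq_integral_itv_bounded.
- exact: measurableT_comp.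
- exact: measurableT_comp.
- by move=> x /fgoo /= ->.
Qed.

Lemma integral_is_cat a c b f v w : a <= c -> c <= b ->
  integral_is `[a, c] f v -> integral_is `[c, b] f w ->
  integral_is `[a, b] f (v + w).
Proof.
move=> ac cb [I1 E1] [I2 E2].
have I2o : mu.-integrable `]c, b] (EFin \o f).
  by apply: integrableS I2 => //; apply: subset_itvr; rewrite bnd_simp.
have U : `[a, b]%classic = `[a, c] `|` `]c, b].
  by rewrite -itv_bndbnd_setU // bnd_simp.
have I : mu.-integrable `[a, b] (EFin \o f).
  have /integrableP[m1 i1] := I1; have /integrableP[m2 i2] := I2o.
  apply/integrableP; split; first by rewrite U; apply/measurable_funU.
  rewrite U ge0_integral_setU //; first exact: lte_add_pinfty.
    rewrite -U; apply: measurableT_comp => //; rewrite U.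
    exact/measurable_funU.
  apply/disj_setPS => y [/=]; rewrite !in_itv /= => /andP[_ yc] /andP[].
  by rewrite ltNge yc.
split => //; rewrite -E1 -E2 -(Rintegral_itv_obnd_cbnd I2o).
have := Rintegral_itvB I; move=> /(_ c).
by rewrite !bnd_simp => /(_ ac cb) <-; rewrite addrC subrK.
Qed.

End IntegralIs.

(** * Integration by parts *)

Section ByParts.
Variable R : realType.
Local Notation mu := (@lebesgue_measure R).

Lemma patch_itvcc (f : R -> R) a b x :
  (f \_ `[a, b]) x = if a <= x <= b then f x else 0.
Proof. by rewrite patchE mem_setE in_itv. Qed.

Lemma C1_integral (q : R -> R) a b :
  (forall x, derivable q x 1) -> continuous (derive1 q) -> a <= b ->
  \int[mu]_(t in `[a, b]) (derive1 q t) = q b - q a.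
Proof.
move=> dq cq; rewrite le_eqVlt => /predU1P[->|ab].
  by rewrite set_itv1 Rintegral_set1 subrr.
rewrite /Rintegral (continuous_FTC2 ab (F := q)); [by []| | |by []].
  exact: continuous_subspaceT.
have qc x : {for x, continuous q}.
  by apply: differentiable_continuous; apply/derivable1_diffP.
split; [by move=> x _; exact: dq| |].
- by apply: cvg_at_right_filter; exact: qc.
- by apply: cvg_at_left_filter; exact: qc.
Qed.

(** Both sides integrate p(t) g(u) over the triangle a <= u <= t <= b. *)
Lemma integral_triangle (p g : R -> R) a b :
  mu.-integrable `[a, b] (EFin \o p) -> mu.-integrable `[a, b] (EFin \o g) ->
  \int[mu]_(t in `[a, b]) (p t * \int[mu]_(u in `[a, t]) g u) =
  \int[mu]_(u in `[a, b]) (g u * \int[mu]_(t in `[u, b]) p t).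
Proof.
move=> Ip Ig.
pose pp := p \_ `[a, b]; pose gg := g \_ `[a, b].
have Ipp : mu.-integrable setT (EFin \o pp).
  by have := Ip; rewrite integrable_mkcond //= restrict_EFin.
have Igg : mu.-integrable setT (EFin \o gg).
  by have := Ig; rewrite integrable_mkcond //= restrict_EFin.
have mpp : measurable_fun setT pp.
  by apply/measurable_EFinP; exact: measurable_int Ipp.
have mgg : measurable_fun setT gg.
  by apply/measurable_EFinP; exact: measurable_int Igg.
pose T := [set z : R * R | z.2 <= z.1].
have mT : measurable T.
  rewrite -[T]setTI.
  by apply: measurable_fun_le.
pose F (z : R * R) := pp z.1 * gg z.2 * \1_T z.
pose G (z : R * R) := pp z.1 * gg z.2.
have mG : measurable_fun setT G.
  by apply: measurable_funM; apply: measurableT_comp.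
have mF : measurable_fun setT F.
  by apply: measurable_funM; last exact: measurable_indic.
have IG : (mu \x mu)%E.-integrable setT (EFin \o G).
  apply/integrable12ltyP; first exact: measurableT_comp.
  have [C C0 CE] : exists2 C : R, 0 <= C & (\int[mu]_u `|(gg u)%:E|)%E = C%:E.
    have /integrableP[_] := Igg; set c := (\int[mu]_u _)%E => cy.
    have c0 : (0 <= c)%E by exact: integral_ge0.
    have cf : c \is a fin_num by rewrite ge0_fin_numE.
    by exists (fine c); rewrite ?fineK //; exact: fine_ge0.
  have E t : (\int[mu]_u `|(EFin \o G) (t, u)| = C%:E * `|(pp t)%:E|)%E.
    rewrite muleC -CE -ge0_integralZl //.
      by apply: eq_integral => u _; rewrite /= /G /= normrM EFinM.
    by apply/measurable_EFinP/measurableT_comp.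
  under eq_integral do rewrite E.
  rewrite ge0_integralZl //; last first.
    by apply/measurable_EFinP/measurableT_comp.
  by have /integrableP[_ ] := Ipp; apply: lte_mul_pinfty.
have IF : (mu \x mu)%E.-integrable setT (EFin \o F).
  apply: le_integrable IG => //; first exact: measurableT_comp.
  move=> z _; rewrite /= lee_fin /F normrM ler_piMr // indicE.
  by case: (_ \in _); rewrite ?normr1 ?normr0.
have := Fubini IF.
have indT t u : \1_T (t, u) = ((u <= t)%R : nat)%:R :> R.
  by rewrite indicE; congr (nat_of_bool _)%:R; apply/idP/idP; rewrite inE.
have E1 t : (\int[mu]_u (EFin \o F) (t, u))%E =
    (((fun t => p t * \int[mu]_(u in `[a, t]) g u) \_ `[a, b]) t)%:E.
  rewrite patch_itvcc; case: ifPn => [/andP[at_ tb]|tab]; last first.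
    rewrite integral0_eq // => u _.
    by rewrite /= /F /pp /= patch_itvcc (negbTE tab) !mul0r.
  have Igt : mu.-integrable `[a, t] (EFin \o g).
    by apply: integrableS Ig => //; apply: subset_itvl; rewrite bnd_simp.
  rewrite EFinM -EFin_Rintegral // -integralZl // [RHS]integral_mkcond.
  apply: eq_integral => u _; rewrite patchE mem_setE in_itv /= /F /= /pp /gg.
  rewrite indT !patch_itvcc at_ tb /= -mulrA.
  have [ut|] := leP u t; last by rewrite andbF !mulr0.
  by rewrite (le_trans ut tb) mulr1 !andbT; case: ifP => _; rewrite ?mulr0.
have E2 u : (\int[mu]_t (EFin \o F) (t, u))%E =
    (((fun u => g u * \int[mu]_(t in `[u, b]) p t) \_ `[a, b]) u)%:E.
  rewrite patch_itvcc; case: ifPn => [/andP[au ub]|uab]; last first.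
    rewrite integral0_eq // => t _.
    by rewrite /= /F /gg /= patch_itvcc (negbTE uab) mulr0 mul0r.
  have Ipu : mu.-integrable `[u, b] (EFin \o p).
    by apply: integrableS Ip => //; apply: subset_itvr; rewrite bnd_simp.
  rewrite EFinM -EFin_Rintegral // -integralZl // [RHS]integral_mkcond.
  apply: eq_integral => t _; rewrite patchE mem_setE in_itv /= /F /= /pp /gg.
  rewrite indT !patch_itvcc au ub /= mulrAC mulrC.
  have [ut|] := leP u t; last by rewrite !mulr0.
  by rewrite (le_trans au ut) mulr1 /=; case: ifP => _; rewrite ?mulr0.
under eq_integral do rewrite E1.
under [in X in _ = X -> _]eq_integral do rewrite E2.
by move=> e; rewrite Rintegral_mkcond [RHS]Rintegral_mkcond; congr fine.
Qed.

Lemma continuous_itv_integrable (f : R -> R) a b :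
  {within `[a, b], continuous f} -> mu.-integrable `[a, b] (EFin \o f).
Proof.
move=> cf; apply: continuous_compact_integrable => //.
exact: segment_compact.
Qed.

Lemma within_continuousM (D : set R) (f g : R -> R) :
  {within D, continuous f} -> {within D, continuous g} ->
  {within D, continuous (fun x => f x * g x)}.
Proof.
move=> cf cg x; apply: (@continuousM _ (subspace D)); [exact: cf|exact: cg].
Qed.

Lemma continuous_integrableM (q g : R -> R) a b :
  {within `[a, b], continuous q} -> mu.-integrable `[a, b] (EFin \o g) ->
  mu.-integrable `[a, b] (EFin \o (fun x => q x * g x)).
Proof.
move=> cq Ig; rewrite (_ : EFin \o _ = (EFin \o q) \* (EFin \o g))%E; last first.
  by apply/funext => x /=; rewrite EFinM.
apply: integrableMr => //.
  by apply: subspace_continuous_measurable_fun.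
have cpt := continuous_compact cq (@segment_compact _ a b).
have [M [_ bq]] := compact_bounded cpt.
by exists M; split; rewrite ?num_real // => ? ? ? ?; exact: bq.
Qed.

(** Integration by parts when one factor is only an indefinite Lebesgue
   integral: after expanding y, the double integral of q' g over the triangle is
   integrated in the other order, where the inner integral is that of q'. *)
Lemma ac_by_parts (q y g : R -> R) a b c :
  (forall x, derivable q x 1) -> continuous (derive1 q) -> a <= b ->
  mu.-integrable `[a, b] (EFin \o g) ->
  (forall t, a <= t <= b -> y t = c + \int[mu]_(u in `[a, t]) g u) ->
  integral_is `[a, b] (fun t => derive1 q t * y t + q t * g t)
    (q b * y b - q a * y a).
Proof.
move=> dq cq ab Ig yE; set D := (D in integral_is _ D _).
have wcq : {within `[a, b], continuous q}.
  apply: continuous_subspaceT => x; apply: differentiable_continuous.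
  exact/derivable1_diffP.
have wcq' : {within `[a, b], continuous (derive1 q)}.
  by apply: continuous_subspaceT => x; exact: cq.
pose Y t := \int[mu]_(u in `[a, t]) g u.
have wcY : {within `[a, b], continuous Y}.
  exact: parameterized_integral_continuous.
have Iq' := continuous_itv_integrable wcq'.
have Iq'c : mu.-integrable `[a, b] (EFin \o (fun t => derive1 q t * c)).
  apply: continuous_itv_integrable; apply: within_continuousM => //.
  by apply: continuous_subspaceT => x; exact: cst_continuous.
have Iq'Y : mu.-integrable `[a, b] (EFin \o (fun t => derive1 q t * Y t)).
  by apply: continuous_itv_integrable; exact: within_continuousM.
have Iqg := continuous_integrableM wcq Ig.
have mab : measurable `[a, b] by [].
have DE : {in `[a, b]%classic, D =1
    fun t => derive1 q t * c + derive1 q t * Y t + q t * g t}.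
  by move=> t; rewrite inE /= in_itv => /yE; rewrite /D => ->; rewrite mulrDr.
have I2 : mu.-integrable `[a, b]
   (EFin \o (fun t => derive1 q t * c + derive1 q t * Y t)).
  exact: integrableD_EFin mab Iq'c Iq'Y.
split.
  apply: (@eq_integrable _ _ _ mu _ mab (EFin \o
    (fun t => derive1 q t * c + derive1 q t * Y t + q t * g t))).
    by move=> t tD; rewrite /= -DE.
  exact: integrableD_EFin mab I2 Iqg.
rewrite (eq_Rintegral mu DE) RintegralD // RintegralD // integral_triangle //.
rewrite RintegralZr // C1_integral //.
have E : {in `[a, b]%classic,
   (fun u => g u * \int[mu]_(t in `[u, b]) derive1 q t) =1
   fun u => q b * g u - q u * g u}.
  move=> u; rewrite inE /= in_itv => /andP[au ub].
  by rewrite C1_integral // -mulrBl mulrC.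
rewrite (eq_Rintegral mu E) RintegralB //; last first.
  exact: integrableZ_EFin.
rewrite RintegralZl // addrA.
rewrite (yE b) ?ab ?lexx // (yE a) ?ab ?lexx // set_itv1 Rintegral_set1 addr0.
by rewrite -/(Y b) addrNK mulrDr mulrBl addrAC.
Qed.

End ByParts.

(** * Matrix-valued functions *)

Section MatrixCalculus.
Variables (R : realType) (p q : nat).
Local Notation C := R[i].
Local Notation mu := (@lebesgue_measure R).
Implicit Types (f : R -> 'M[C]_(p, q)) (L : 'M[C]_(p, q)).

Lemma ReD (x y : C) : complex.Re (x + y) = complex.Re x + complex.Re y.
Proof. by case: x y => [? ?] []. Qed.

Lemma ImD (x y : C) : complex.Im (x + y) = complex.Im x + complex.Im y.
Proof. by case: x y => [? ?] []. Qed.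

Lemma complex_mxP L L' :
  (forall i j, complex.Re (L i j) = complex.Re (L' i j) /\
               complex.Im (L i j) = complex.Im (L' i j)) -> L = L'.
Proof.
move=> LL; apply/matrixP => i j; apply/eqP; rewrite eq_complex.
by have [-> ->] := LL i j; rewrite !eqxx.
Qed.

Lemma mx_C1_cvg_right f a : mx_C1 f -> mx_cvg f a^'+ (f a).
Proof.
move=> C1f i j; have [[dr _] [di _]] := C1f i j.
by split; apply: cvg_at_right_filter; apply: differentiable_continuous;
  apply/derivable1_diffP.
Qed.

Lemma mx_C1_cvg_left f a : mx_C1 f -> mx_cvg f a^'- (f a).
Proof.
move=> C1f i j; have [[dr _] [di _]] := C1f i j.
by split; apply: cvg_at_left_filter; apply: differentiable_continuous;
  apply/derivable1_diffP.
Qed.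

Lemma mx_cvg_near f f' (G : set_system R) L : Filter G ->
  (\forall x \near G, f x = f' x) -> mx_cvg f G L -> mx_cvg f' G L.
Proof.
move=> FG ff' fL i j; have [r1 i1] := fL i j.
split.
  apply: cvg_trans r1; apply: near_eq_cvg.
  by apply: filterS ff' => x; rewrite /re_ent => ->.
apply: cvg_trans i1; apply: near_eq_cvg.
by apply: filterS ff' => x; rewrite /im_ent => ->.
Qed.

Lemma mx_cvg_unique f (G : set_system R) L L' : ProperFilter G ->
  mx_cvg f G L -> mx_cvg f G L' -> L = L'.
Proof.
move=> PG fL fL'; apply: complex_mxP => i j.
have [r1 i1] := fL i j; have [r2 i2] := fL' i j.
by split; [apply: (cvg_unique _ r1 r2)|apply: (cvg_unique _ i1 i2)].
Qed.

Lemma mx_rlim_eq f t L : mx_cvg f t^'+ L -> mx_rlim f t = L.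
Proof.
move=> fL; apply: complex_mxP => i j; have [r1 i1] := fL i j.
by rewrite mxE /=; split; apply: cvg_lim.
Qed.

Lemma mx_derive_near f f' t : (\forall x \near t, f x = f' x) ->
  mx_derive f t = mx_derive f' t.
Proof.
move=> ff'; apply/matrixP => i j; rewrite !mxE !derive1E.
congr (_ +i* _)%C; apply: near_eq_derive; apply: filterS ff' => x.
  by rewrite /re_ent => ->.
by rewrite /im_ent => ->.
Qed.

(** Integration by parts in each real and imaginary entry.  Ya stands for the
   right limit of Y at a, which differs from Y a when a is a jump time. *)
Lemma energy_piece (Q Y g : R -> 'M[C]_(p, q)) Ya a b :
  mx_C1 Q -> a < b -> mx_integrable `[a, b] g ->
  (forall t, a < t <= b -> Y t = Ya + mx_integral a t g) ->
  integral_is `[a, b]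
    (fun t => rip (mx_derive Q t) (Y t) + rip (Q t) (g t))
    (rip (Q b) (Y b) - rip (Q a) Ya).
Proof.
move=> C1Q ab Ig YE.
pose yr i j t := complex.Re (Ya i j) + \int[mu]_(u in `[a, t]) re_ent g i j u.
pose yi i j t := complex.Im (Ya i j) + \int[mu]_(u in `[a, t]) im_ent g i j u.
pose D t := \sum_i \sum_j
  ((derive1 (re_ent Q i j) t * yr i j t + re_ent Q i j t * re_ent g i j t) +
   (derive1 (im_ent Q i j) t * yi i j t + im_ent Q i j t * im_ent g i j t)).
apply: (@integral_is_eqoo _ _ _ D) => [t /andP[at_ tb]|].
  rewrite !rip_sum -big_split; apply: eq_bigr => i _ /=.
  rewrite -big_split; apply: eq_bigr => j _ /=.
  by rewrite YE ?at_ ?ltW // !mxE ReD ImD /= addrACA.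
have -> : rip (Q b) (Y b) - rip (Q a) Ya = \sum_i \sum_j
   ((re_ent Q i j b * yr i j b - re_ent Q i j a * yr i j a) +
    (im_ent Q i j b * yi i j b - im_ent Q i j a * yi i j a)).
  rewrite !rip_sum -sumrB; apply: eq_bigr => i _ /=.
  rewrite -sumrB; apply: eq_bigr => j _ /=.
  rewrite YE ?ab ?lexx // !mxE ReD ImD /=.
  by rewrite /yr /yi !set_itv1 !Rintegral_set1 !addr0 opprD addrACA.
apply: integral_is_sum => // i; apply: integral_is_sum => // j.
have [[dr cr] [di ci]] := C1Q i j; have [Igr Igi] := Ig i j.
by apply: integral_isD => //; apply: ac_by_parts => //; exact: ltW.
Qed.

End MatrixCalculus.

(** * Energy balance across the jumps *)

Section Pieces.
Variables (R : realType).
Local Notation mu := (@lebesgue_measure R).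

(** Induction on the list of breakpoints, cutting at each one that lies inside the
   interval; this spares sorting them. *)
Lemma split_breakpoints (Q : R -> R -> Prop) (s : seq R) l h :
  (forall a c b, l <= a -> a < c -> c < b -> b <= h ->
     Q a c -> Q c b -> Q a b) ->
  (forall a b, l <= a -> a < b -> b <= h ->
     (forall x, x \in s -> ~ (a < x < b)) -> Q a b) ->
  forall a b, l <= a -> a < b -> b <= h -> Q a b.
Proof.
move=> Qcat; elim: s => [|x s IH] Q0; first by move=> *; exact: Q0.
apply: IH => a b la ab bh sab.
have [/andP[ax xb]|xab] := boolP (a < x < b); last first.
  apply: Q0 => // y; rewrite inE => /predU1P[->|]; [exact/negP|exact: sab].
have split_at c d : l <= c -> c < d -> d <= h -> a <= c -> d <= b ->
    ~~ (c < x < d) -> Q c d.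
  move=> lc cd dh ac db xcd; apply: Q0 => // y.
  rewrite inE => /predU1P[->|ys /andP[cy yd]]; first exact/negP.
  by apply: (sab y ys); rewrite (le_lt_trans ac cy) (lt_le_trans yd db).
apply: (Qcat a x b) => //; apply: split_at => //;
  rewrite ?ltxx ?andbF ?(ltW ax) ?(ltW xb) //.
- by rewrite (le_trans (ltW xb)).
- by rewrite (le_trans la) ?ltW.
Qed.

Lemma Rintegral_itvccB (g : R -> R) a s t : a <= s -> s <= t ->
  mu.-integrable `[a, t] (EFin \o g) ->
  \int[mu]_(u in `[s, t]) g u =
  \int[mu]_(u in `[a, t]) g u - \int[mu]_(u in `[a, s]) g u.
Proof.
move=> as_ st I; rewrite -Rintegral_itv_obnd_cbnd.
  by rewrite -(Rintegral_itvB I) // bnd_simp.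
by apply: integrableS I => //; apply: subset_itvr; rewrite bnd_simp.
Qed.

Lemma integral_right_cvg (y g : R -> R) a t : a < t ->
  mu.-integrable `[a, t] (EFin \o g) ->
  (forall s, a < s < t -> y t = y s + \int[mu]_(u in `[s, t]) g u) ->
  y x @[x --> a^'+] --> y t - \int[mu]_(u in `[a, t]) g u.
Proof.
move=> at_ Ig yE.
have G0 : (\int[mu]_(u in `[a, s]) g u) @[s --> a^'+] --> 0.
  apply: cvg_at_right_filter.
  exact: (parameterized_integral_cvg_left at_ Ig).
rewrite -[X in _ --> X]addr0.
have H := cvgD (@cvg_cst _ (y t - \int[mu]_(u in `[a, t]) g u) _ a^'+ _) G0.
apply: (cvg_trans _ (H _ _)).
apply: near_eq_cvg; near=> s.
have as_ : a < s by near: s; exact: nbhs_right_gt.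
have st : s < t by near: s; exact: nbhs_right_lt.
rewrite /= (yE s) ?as_ // (Rintegral_itvccB (ltW as_) (ltW st) Ig).
by rewrite fctE -addrA [- _ + _]addrC -opprB subrK.
Unshelve. all: by end_near. Qed.

End Pieces.

Section Energy.
Variables (R : realType) (n m : nat) (S : impulsive_data R n m).
Local Notation C := R[i].
Local Notation mu := (@lebesgue_measure R).
Local Notation t0 := (t0 S).
Local Notation t1 := (t1 S).
(* Jp k is the value of the state just after the k-th jump. *)
Variables (P Y g : R -> 'M[C]_n) (Jp : nat -> 'M[C]_n).
Hypothesis hS : impulsive_system S.
Hypothesis P_C1 : piecewise_C1 S P.
Hypothesis g_int : mx_integrable `[t0, t1] g.
Hypothesis Y_flow : forall s t, t0 <= s -> s <= t -> t <= t1 ->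
  (forall r, s <= r < t -> ~ is_jump_time S r) ->
  Y t = Y s + mx_integral s t g.
Hypothesis Y_jump : forall k, is_jump_index S k ->
  mx_cvg Y (jump S k)^'+ (Jp k).

Let D t := rip (mx_derive P t) (Y t) + rip (P t) (g t).
Let phi t := rip (P t) (Y t).
Let delta k := rip (mx_rlim P (jump S k)) (Jp k) - phi (jump S k).

(** The flow equation starts at interior points s; letting s decrease to a
   replaces Y a, which is the value before a possible jump at a, by the right
   limit. *)
Lemma flow_from_limit a b Ya : t0 <= a -> b <= t1 ->
  (forall r, a < r < b -> ~ is_jump_time S r) -> mx_cvg Y a^'+ Ya ->
  forall t, a < t <= b -> Y t = Ya + mx_integral a t g.
Proof.
move=> t0a bt1 nojump YYa t /andP[at_ tb].
have t0t : t0 <= t by rewrite (le_trans t0a) ?ltW.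
have tt1 : t <= t1 by rewrite (le_trans tb).
suff H : mx_cvg Y a^'+ (Y t - mx_integral a t g).
  by rewrite (mx_cvg_unique _ YYa H) subrK.
have YE s : a < s < t -> Y t = Y s + mx_integral s t g.
  move=> /andP[as_ st]; apply: Y_flow => //;
    [exact: le_trans (ltW as_)|exact: ltW|].
  move=> r /andP[sr rt]; apply: nojump.
  by rewrite (lt_le_trans as_ sr) (lt_le_trans rt tb).
move=> i j; have [Ir Ii] := g_int i j.
have sub : `[a, t] `<=` `[t0, t1].
  by apply: subset_itv; rewrite bnd_simp.
have -> : complex.Re ((Y t - mx_integral a t g) i j) =
   re_ent Y i j t - \int[mu]_(u in `[a, t]) re_ent g i j u.
  by rewrite !mxE ReD.
have -> : complex.Im ((Y t - mx_integral a t g) i j) =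
   im_ent Y i j t - \int[mu]_(u in `[a, t]) im_ent g i j u.
  by rewrite !mxE ImD.
split; apply: integral_right_cvg => //.
- exact: integrableS Ir.
- by move=> s /YE YEs; rewrite /re_ent YEs !mxE ReD.
- exact: integrableS Ii.
- by move=> s /YE YEs; rewrite /im_ent YEs !mxE ImD.
Qed.

Lemma jump_inj k l : is_jump_index S k -> is_jump_index S l ->
  jump S k = jump S l -> k = l.
Proof.
move=> /andP[k0 _] /andP[l0 _] kl; have [lt|lt|//] := ltngtP k l.
  by have := jump_increasing hS k0 lt; rewrite kl ltxx.
by have := jump_increasing hS l0 lt; rewrite kl ltxx.
Qed.

Lemma jump_in k : is_jump_index S k -> t0 < jump S k < t1.
Proof. by move=> /andP[k0 kN]; rewrite (jump_inside hS). Qed.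

(* The jump at the left end is counted and the one at the right end is not, so
   that the contributions add up under concatenation. *)
Let energy_on a b := integral_is `[a, b] D
  (phi b - phi a - \sum_(1 <= k < (njumps S).+1 | a <= jump S k < b) delta k).

Lemma energy_on_piece (Q : R -> 'M[C]_n) a b : t0 <= a -> a < b -> b <= t1 ->
  mx_C1 Q -> (forall x, a < x < b -> P x = Q x) ->
  (forall r, a < r < b -> ~ is_jump_time S r) ->
  energy_on a b.
Proof.
move=> t0a ab bt1 C1Q PQ nojump; have [_ [P_left P_right]] := P_C1.
have g_ab : mx_integrable `[a, b] g.
  move=> i j; have [Ir Ii] := g_int i j.
  have sub : `[a, b] `<=` `[t0, t1] by apply: subset_itv; rewrite bnd_simp.
  by split; [exact: integrableS Ir|exact: integrableS Ii].
have nearPQ : \forall x \near a^'+, Q x = P x.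
  near=> x; rewrite PQ //; apply/andP; split; near: x.
    exact: nbhs_right_gt.
  exact: nbhs_right_lt.
have Pa : mx_cvg P a^'+ (Q a).
  by apply: mx_cvg_near nearPQ _; exact: mx_C1_cvg_right.
have Pb : P b = Q b.
  apply: (@mx_cvg_unique _ _ _ P b^'-).
    by apply: P_left; rewrite (le_lt_trans t0a ab).
  apply: (@mx_cvg_near _ _ _ Q); last exact: mx_C1_cvg_left.
  near=> x; rewrite PQ //; apply/andP; split; near: x.
    exact: nbhs_left_gt.
  exact: nbhs_left_lt.
have piece Ya : (forall t, a < t <= b -> Y t = Ya + mx_integral a t g) ->
    integral_is `[a, b] D (phi b - rip (Q a) Ya).
  move=> YE; rewrite /phi Pb; move: (energy_piece C1Q ab g_ab YE).
  apply: integral_is_eqoo => x xab.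
  suff dPQ : mx_derive P x = mx_derive Q x by rewrite /D dPQ (PQ x xab).
  apply: mx_derive_near; near=> y; apply: PQ.
  have : y \in `]a, b[ by near: y; apply: near_in_itvoo; rewrite in_itv.
  by rewrite in_itv.
(* At a jump time the right limits give the jump term; elsewhere they are the
   values at a. *)
have [[k jk ak]|nja] := pselect (is_jump_time S a).
  rewrite /energy_on (_ : \sum_(1 <= _ < _ | _) _ = delta k).
    rewrite /delta -ak (mx_rlim_eq Pa) opprB addrA subrK.
    by apply: piece; apply: flow_from_limit => //; rewrite ak; exact: Y_jump.
  rewrite big_mkcond (bigD1_seq k) ?mem_index_iota ?iota_uniq //=; last first.
  rewrite -ak lexx ab /= big1_seq ?addr0 // => l /andP[lk].
  rewrite mem_index_iota ltnS => jl; case: ifP => // /andP[].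
  rewrite le_eqVlt => /predU1P[al|al] lb; exfalso.
    by move/eqP: lk; apply; apply: jump_inj => //; rewrite -al.
  by apply: (nojump (jump S l)); [rewrite al|exists l].
rewrite /energy_on big1_seq ?subr0.
  have -> : phi a = rip (Q a) (Y a).
    have at1 : a < t1 by exact: lt_le_trans bt1.
    rewrite /phi; congr rip; apply: mx_cvg_unique Pa.
    by apply: P_right => //; rewrite t0a.
  apply: piece => t /andP[at_ tb]; apply: Y_flow => //;
    [exact: ltW|exact: le_trans bt1|].
  move=> r /andP[]; rewrite le_eqVlt => /predU1P[<- //|ar] rt.
  by apply: nojump; rewrite ar (lt_le_trans rt tb).
move=> k /andP[]; rewrite le_eqVlt => /andP[/orP[/eqP ak|ak] kb].
  rewrite mem_index_iota ltnS => jk; exfalso; apply: nja; by exists k.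
rewrite mem_index_iota ltnS => jk; exfalso.
by apply: (nojump (jump S k)); [rewrite ak|exists k].
Unshelve. all: end_near.
Qed.

Lemma energy_balance : integral_is `[t0, t1] D
  (phi t1 - phi t0 - \sum_(1 <= k < (njumps S).+1) delta k).
Proof.
have [[s sP] _] := P_C1.
have t01 : t0 < t1 by rewrite /Defs.t1 ltrDl (horizon_gt0 hS).
suff : energy_on t0 t1.
  rewrite /energy_on big_nat_cond (eq_bigl (fun k => 1 <= k < (njumps S).+1)%N).
    by rewrite -big_nat.
  move=> k; rewrite ltnS; case: (boolP (0 < k <= njumps S)%N) => //= jk.
  by have /andP[/ltW -> ->] := jump_in jk.
apply: (@split_breakpoints _ energy_on
  (s ++ [seq jump S k | k <- index_iota 1 (njumps S).+1]) t0 t1) => //.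
  move=> a c b t0a ac cb bt1 Eac Ecb.
  have := integral_is_cat (ltW ac) (ltW cb) Eac Ecb; rewrite /energy_on.
  congr (integral_is _ _ _).
  rewrite [in RHS](bigID (fun k => jump S k < c)) /= addrACA -opprD.
  congr (_ - (_ + _)); first by rewrite addrC addrA subrK.
    apply: eq_bigl => k.
    case: (ltP (jump S k) c) => [kc|]; last by rewrite !andbF.
    by rewrite (lt_trans kc cb) !andbT.
  apply: eq_bigl => k; rewrite -leNgt; case: (leP c (jump S k)) => [ck|_].
    by rewrite (le_trans (ltW ac) ck) andbT.
  by rewrite andbF.
move=> a b t0a ab bt1 sab.
have [Q C1Q PQ] : exists2 Q : R -> 'M[C]_n, mx_C1 Q &
    forall x, a < x < b -> P x = Q x.
  by apply: sP => // x xs; apply: sab; rewrite mem_cat xs.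
apply: (energy_on_piece t0a ab bt1 C1Q PQ) => r rab [k jk rk].
apply: (sab r) => //; rewrite mem_cat; apply/orP; right.
by apply/mapP; exists k; rewrite // mem_index_iota.
Qed.

End Energy.

(** * Lower bound for the cost, and feedback trajectories *)

Section Verification.
Variables (R : realType) (n m : nat) (S : impulsive_data R n m).
Local Notation C := R[i].
Local Notation mu := (@lebesgue_measure R).
Local Notation t0 := (t0 S).
Local Notation t1 := (t1 S).
Local Notation E := (Emx R n m).
Hypothesis hS : impulsive_system S.

Lemma ae_not_jump : {ae mu, forall t, ~ is_jump_time S t}.
Proof.
pose A := [set jump S k | k in [set k | is_jump_index S k]].
have cA : countable A.
  apply/finite_set_countable/finite_image.
  apply/(sub_finite_set _ (finite_II (njumps S).+1)).
  by move=> k /= /andP[_]; rewrite ltnS.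
exists A; split.
- exact: countable_measurable.
- exact: countable_lebesgue_measure0.
- by move=> t /= /contrapT[k jk ->]; exists k.
Qed.

Definition state (X : R -> 'M[C]_(n + m)) t : 'M[C]_n := E *m X t *m E ^t*.

(** A trajectory, except for the measurability of its running cost, which the
   energy balance provides when the gains are those of the Riccati equation. *)
Record dynamics (X10 : 'M[C]_n) (X : R -> 'M[C]_(n + m)) : Prop := {
  dyn_psd : forall t, t \in `[t0, t1] -> psdmx (X t);
  dyn_init : state X t0 = X10;
  dyn_flow : flows S (state X) (fun t => F S t (X t));
  dyn_jump : forall k, is_jump_index S k ->
    mx_cvg (state X) (jump S k)^'+ (J S k (X (jump S k))) }.

Lemma trajectory_dynamics X10 X : trajectory S X10 X -> dynamics X10 X.
Proof. by case=> *; split. Qed.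

Lemma flows_ae (Y G G' : R -> 'M[C]_n) :
  (forall t, t \in `[t0, t1] -> ~ is_jump_time S t -> G t = G' t) ->
  flows S Y G -> flows S Y G'.
Proof.
move=> GG' [g [Ig Yg Dg]]; exists g; split=> //.
have := ae_and Dg ae_not_jump; apply: ae_imp => t [H nj] t01.
by have [? ?] := H t01; rewrite -GG'.
Qed.

(** Used to know that P has a right limit at a jump time at all: this limit is
   defined by a total operator. *)
Lemma piecewise_C1_rlim (P : R -> 'M[C]_n) a : piecewise_C1 S P ->
  t0 <= a < t1 -> mx_cvg P a^'+ (mx_rlim P a).
Proof.
move=> [[s sP] _] /andP[t0a at1].
suff [L PL] : exists L, mx_cvg P a^'+ L by rewrite (mx_rlim_eq PL).
apply: (@split_breakpoints _ (fun a _ => exists L, mx_cvg P a^'+ L) s t0 t1)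
  (lexx _) => //.
move=> {t0a at1}a b t0a ab bt1 sab; have [Q C1Q PQ] := sP a b t0a ab bt1 sab.
exists (Q a); apply: mx_cvg_near (mx_C1_cvg_right _ C1Q).
near=> x; rewrite PQ //; apply/andP; split; near: x.
  exact: nbhs_right_gt.
exact: nbhs_right_lt.
Unshelve. all: end_near.
Qed.

Lemma mx_cvg_trmxC p q (f : R -> 'M[C]_(p, q)) (G : set_system R) L :
  Filter G -> mx_cvg f G L -> mx_cvg (fun t => (f t) ^t*) G (L ^t*).
Proof.
move=> FG fL i j; have [r1 i1] := fL j i.
have Re_tr (A : 'M[C]_(p, q)) : complex.Re ((A ^t*) i j) = complex.Re (A j i).
  by rewrite !mxE; case: (A j i).
have Im_tr (A : 'M[C]_(p, q)) : complex.Im ((A ^t*) i j) = - complex.Im (A j i).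
  by rewrite !mxE; case: (A j i).
split; rewrite ?Re_tr ?Im_tr.
  rewrite (_ : re_ent _ i j = re_ent f j i) //.
  by apply/funext => t; exact: Re_tr.
rewrite (_ : im_ent _ i j = fun t => - im_ent f j i t); first exact: cvgN.
by apply/funext => t; exact: Im_tr.
Qed.

Lemma rlim_herm (P : R -> 'M[C]_n) a : piecewise_C1 S P ->
  (forall t, t \in `[t0, t1] -> P t \is hermsymmx) ->
  t0 <= a < t1 -> mx_rlim P a \is hermsymmx.
Proof.
move=> P1 Ph a01; have PL := piecewise_C1_rlim P1 a01; apply/hermP.
apply: (mx_cvg_unique _ (mx_cvg_trmxC _ PL)).
apply: mx_cvg_near PL; have /andP[t0a at1] := a01.
near=> t; apply/esym/hermP/Ph; rewrite in_itv /=; apply/andP; split.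
  by apply: le_trans t0a _; apply: ltW; near: t; exact: nbhs_right_gt.
by apply: ltW; near: t; exact: nbhs_right_lt.
Unshelve. all: end_near.
Qed.

Variable P : R -> 'M[C]_n.
Hypothesis ricP : riccati_solution S P.

(** Here w is - d/dt <P, X_1>, written through the integrable density of the
   state, hence integrable. *)
Lemma energy_balance_dynamics X10 X : dynamics X10 X -> exists w : R -> R,
  [/\ mu.-integrable `[t0, t1] (EFin \o w),
      {ae mu, forall t, `[t0, t1]%classic t -> riccati_lmi (CZ S P t) /\
         running_cost S X t = w t + rip (CZ S P t) (X t)}
    & rip (P t0) X10 = \int[mu]_(t in `[t0, t1]) w t +
        \sum_(1 <= k < (njumps S).+1)
          (rip (Zj S k) (X (jump S k)) - rip (DZ_at S P k) (X (jump S k))) +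
        rip (P t1) (state X t1)].
Proof.
move=> [Xpsd X0 [g [Ig Yg gE]] Xjump].
have [Pherm P1 lmi _] := ricP.
pose D t := rip (mx_derive P t) (state X t) + rip (P t) (g t).
have [ID E0] : integral_is `[t0, t1] D _ := energy_balance hS P1 Ig Yg Xjump.
have Xherm t : t \in `[t0, t1] -> X t \is hermsymmx by move=> /Xpsd[].
exists (fun t => (-1) * D t); split.
- exact: integrableZ_EFin.
- apply: ae_imp (ae_and lmi gE) => t [lmit gEt] t01.
  have [_ gt] := gEt t01; split; first exact: lmit.
  have [_ adj] := F_adjoint hS t01.
  rewrite /CZ !ripDl /rip !mxip_compress -adj ?Pherm ?Xherm //.
  by rewrite /D /rip -gt mulN1r addrA addNr add0r.
rewrite RintegralZl // mulN1r E0 X0.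
set a := rip (P t1) _; set b := rip (P t0) _.
suff -> : \sum_(1 <= k < (njumps S).+1)
      (rip (Zj S k) (X (jump S k)) - rip (DZ_at S P k) (X (jump S k))) =
    - \sum_(1 <= k < (njumps S).+1)
      (rip (mx_rlim P (jump S k)) (J S k (X (jump S k))) -
       rip (P (jump S k)) (state X (jump S k))) by ring.
rewrite -sumrN; apply: eq_big_nat => k; rewrite ltnS => jk.
have k0 : (0 < k)%N by case/andP: jk.
have /andP[t0k kt1] := jump_in hS jk.
have k01 : jump S k \in `[t0, t1] by rewrite in_itv /= !ltW.
have [_ adj] := J_adjoint hS k0.
rewrite /DZ_at /DZ !ripDl ripNl /rip !mxip_compress -adj ?Xherm //; last first.
  by apply: rlim_herm => //; rewrite (ltW t0k).
by ring.
Qed.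

Lemma running_cost_ge0 X t : (forall t, t \in `[t0, t1] -> psdmx (X t)) ->
  t \in `[t0, t1] -> 0 <= running_cost S X t.
Proof.
by move=> Xpsd t01; apply: rip_psd_ge0; [exact: (Z_psd hS)|exact: Xpsd].
Qed.

(** A running cost of infinite integral is covered as well, because only a lower
   bound on the integral is used. *)
Lemma verification X10 X : trajectory S X10 X ->
  ((rip (P t0) X10)%:E <= terminal_cost S (P t1) X)%E.
Proof.
move=> tX; have dX := trajectory_dynamics tX.
have Xpsd := dyn_psd dX; have [_ _ _ lmik] := ricP.
have [w [Iw wE ->]] := energy_balance_dynamics dX.
rewrite /terminal_cost /cost -addeA -addrA 2!EFinD; apply: leeD.
  apply: ge0_ae_le_Rintegral => //.
    by move=> t t01; exact: running_cost_ge0.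
  apply: ae_imp wE => t H t01; have [[Lpsd _] ->] := H t01.
  by rewrite lerDl; exact: rip_psd_ge0 Lpsd (Xpsd _ t01).
apply: leeD => //; rewrite lee_fin big_nat [leRHS]big_nat.
apply: ler_sum => k; rewrite ltnS => jk.
have /andP[t0k kt1] := jump_in hS jk; have [Lpsd _] := lmik k jk.
rewrite gerBl; apply: (rip_psd_ge0 Lpsd); apply: Xpsd.
by rewrite in_itv /= (ltW t0k) (ltW kt1).
Qed.

Record feedback (X : R -> 'M[C]_(n + m)) : Prop := {
  feedback_flow : forall t, t \in `[t0, t1] -> ~ is_jump_time S t ->
    X t = gain_lift (flow_gain S P t) (state X t);
  feedback_jump : forall k, is_jump_index S k ->
    X (jump S k) = gain_lift (jump_gain S P k) (state X (jump S k)) }.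

(** The terms in C_Z and D_Z vanish, so the running cost is almost everywhere the
   integrable function w of the energy balance; this gives both its
   measurability and equality in the verification bound. *)
Lemma feedback_trajectory X10 X : dynamics X10 X -> feedback X ->
  trajectory S X10 X /\ terminal_cost S (P t1) X = (rip (P t0) X10)%:E.
Proof.
move=> dX [Xf Xj].
have Xpsd := dyn_psd dX; have [_ _ _ lmik] := ricP.
have [w [Iw wE ->]] := energy_balance_dynamics dX.
have wE' : {ae mu, forall t, `[t0, t1]%classic t -> running_cost S X t = w t}.
  apply: ae_imp (ae_and wE ae_not_jump) => t [H nj] t01.
  have [L ->] := H t01; rewrite [in X in rip _ X]Xf //.
  by rewrite /rip riccati_gain_orth // addr0.
split.
  case: dX => *; split => //; exists w => //.
  by apply/measurable_EFinP; exact: measurable_int Iw.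
rewrite /terminal_cost /cost (ge0_ae_eq_Rintegral _ Iw) //; last first.
  by move=> t t01; exact: running_cost_ge0.
rewrite -!EFinD; congr ((_ + _ + _)%:E).
apply: eq_big_nat => k; rewrite ltnS => jk.
rewrite [in X in _ - rip _ X](Xj k jk) /rip.
by rewrite (riccati_gain_orth _ (lmik k jk)) subr0.
Qed.

End Verification.

(** * Moment equations and closed loops *)

Section ClosedLoop.
Variables (R : realType) (n m : nat) (S : impulsive_data R n m).
Local Notation C := R[i].
Local Notation t0 := (t0 S).
Local Notation t1 := (t1 S).
Hypothesis hS : impulsive_system S.
Variables (X10 : 'M[C]_n) (P : R -> 'M[C]_n).
Hypothesis ricP : riccati_solution S P.

(** At a jump time the input block is the jump feedback, whose index is recovered
   from the time by choice. *)
Definition closed_loop (Sigma : R -> 'M[C]_n) (t : R) : 'M[C]_(n + m) :=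
  let K := if `[< is_jump_time S t >]
           then jump_gain S P
                  (xget 0%N [set k | is_jump_index S k /\ t = jump S k])
           else flow_gain S P t in
  gain_lift K (Sigma t).

Lemma state_closed_loop Sigma t : state (closed_loop Sigma) t = Sigma t.
Proof. by rewrite /state EmxE ulsubmx_gain_lift. Qed.

Lemma closed_loop_flow Sigma t : ~ is_jump_time S t ->
  closed_loop Sigma t = gain_lift (flow_gain S P t) (Sigma t).
Proof. by move=> nj; rewrite /closed_loop asboolF. Qed.

Lemma closed_loop_jump Sigma k : is_jump_index S k ->
  closed_loop Sigma (jump S k) = gain_lift (jump_gain S P k) (Sigma (jump S k)).
Proof.
move=> jk; have jt : is_jump_time S (jump S k) by exists k.
rewrite /closed_loop (asboolT jt).
case: xgetP => [l _ [jl kl]|/(_ k) nk]; last by case: nk.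
by rewrite (_ : l = k) //; apply: (jump_inj hS) => //; rewrite -kl.
Qed.

Lemma closed_loop_feedback Sigma : feedback S P (closed_loop Sigma).
Proof.
split=> [t _ nj|k jk]; rewrite state_closed_loop; first exact: closed_loop_flow.
exact: closed_loop_jump.
Qed.

Lemma closed_loop_dynamics Sigma : moment_solution S X10 P Sigma ->
  dynamics S X10 (closed_loop Sigma).
Proof.
have stE : state (closed_loop Sigma) = Sigma.
  by apply/funext => t; exact: state_closed_loop.
move=> [Spsd S0 Sflow Sjump]; split; rewrite ?stE.
- by move=> t /Spsd; exact: psdmx_gain_lift.
- exact: S0.
- by apply: flows_ae Sflow => t _ nj; rewrite closed_loop_flow.
- by move=> k jk; rewrite closed_loop_jump; [exact: Sjump|exact: jk].
Qed.

Lemma moment_optimal Sigma : moment_solution S X10 P Sigma ->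
  exists2 X, optimal_closed_loop S X10 (P t1) P X & state X t1 = Sigma t1.
Proof.
move=> mS; exists (closed_loop Sigma); last exact: state_closed_loop.
have [tX cX] := feedback_trajectory hS ricP (closed_loop_dynamics mS)
  (closed_loop_feedback Sigma).
split; first exact: ricP.
- exact: erefl.
- by split=> [|X' tX']; [exact: tX|rewrite cX; exact: verification tX'].
- move=> t _ nj; rewrite (closed_loop_flow _ nj) ulsubmx_gain_lift.
  by rewrite block_mxKdl block_mxKdr.
- move=> k jk; rewrite (closed_loop_jump _ jk) ulsubmx_gain_lift.
  by rewrite block_mxKdl block_mxKdr.
Qed.

Lemma optimal_moment M X : optimal_closed_loop S X10 M P X ->
  moment_solution S X10 P (state X).
Proof.
move=> [_ _ [tX _] Xf Xj]; have dX := trajectory_dynamics tX.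
have [Xpsd X0 Xflow Xjump] := dX.
split.
- by move=> t /Xpsd; exact: psdmx_congr.
- exact: X0.
- apply: flows_ae Xflow => t t01 nj.
  have [Xh _] := Xpsd t t01; have [dl dr] := Xf t t01 nj.
  by rewrite /Acl /state EmxE; congr (F S t _); exact: gain_liftP.
- move=> k jk; have /andP[t0k kt1] := jump_in hS jk.
  have k01 : jump S k \in `[t0, t1] by rewrite in_itv /= (ltW t0k) (ltW kt1).
  have [Xh _] := Xpsd _ k01; have [dl dr] := Xj k jk.
  have XE : X (jump S k) = gain_lift (jump_gain S P k) (state X (jump S k)).
    by rewrite /state EmxE; exact: gain_liftP.
  by rewrite /Bcl -XE; exact: Xjump.
Qed.

(** With the final state prescribed, the cost and the cost with terminal weight
   differ by the constant <P(t1), X1f>. *)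
Lemma steering_value_tpbvp X1f Sigma : moment_solution S X10 P Sigma ->
  Sigma t1 = X1f ->
  steering_value S X10 X1f = (rip (P t0) X10 - rip (P t1) X1f)%:E.
Proof.
move=> mS Sf.
have costE X : state X t1 = X1f ->
    terminal_cost S (P t1) X = (cost S X + (rip (P t1) X1f)%:E)%E.
  by move=> <-.
apply/eqP; rewrite eq_le; apply/andP; split.
  apply: ge_ereal_inf; exists (cost S (closed_loop Sigma)).
    exists (closed_loop Sigma); last by [].
    split; last by rewrite -[LHS]/(state _ _) state_closed_loop.
    by have [] := feedback_trajectory hS ricP (closed_loop_dynamics mS)
      (closed_loop_feedback Sigma).
  have [_ ] := feedback_trajectory hS ricP (closed_loop_dynamics mS)
      (closed_loop_feedback Sigma).
  rewrite costE ?state_closed_loop // EFinB => <-.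
  by rewrite addeK.
apply: le_ereal_inf_tmp => _ [X [tX Xf] <-].
rewrite EFinB leeBlDr // -costE //; exact: verification.
Qed.

End ClosedLoop.

Theorem theorem4p6 (R : realType) (n m : nat) (hn : (0 < n)%N) (hm : (0 < m)%N)
    (S : impulsive_data R n m) (hS : impulsive_system S)
    (X10 X1f : 'M[R[i]%C]_n) (hX10 : psdmx X10) (hX1f : psdmx X1f) :
  (* a solution of the TPBVP satisfies the steering condition *)
  (forall (P Sigma : R -> 'M[R[i]%C]_n) (M : 'M[R[i]%C]_n),
     tpbvp S X10 X1f P Sigma M ->
     (exists X, optimal_closed_loop S X10 M P X /\ steers S X1f X) /\
     (moment_determinate S X10 P ->
      forall X, optimal_closed_loop S X10 M P X -> steers S X1f X)) /\
  (* the steering condition yields a solution of the TPBVP *)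
  (forall (M : 'M[R[i]%C]_n) (P : R -> 'M[R[i]%C]_n)
          (X : R -> 'M[R[i]%C]_(n + m)),
     psdmx M -> optimal_closed_loop S X10 M P X -> steers S X1f X ->
     (exists Sigma, moment_solution S X10 P Sigma /\
                    tpbvp S X10 X1f P Sigma M) /\
     (moment_determinate S X10 P ->
      forall Sigma, moment_solution S X10 P Sigma ->
                    tpbvp S X10 X1f P Sigma M)) /\
  (* the optimal cost *)
  (forall (P Sigma : R -> 'M[R[i]%C]_n) (M : 'M[R[i]%C]_n),
     tpbvp S X10 X1f P Sigma M ->
     steering_value S X10 X1f =
       (complex.Re (mxip (P (t0 S)) X10) - complex.Re (mxip M X1f))%:E).
Proof.
have t1_in : t1 S \in `[t0 S, t1 S].
  by rewrite in_itv /= lexx andbT lerDl (ltW (horizon_gt0 hS)).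
split; [|split].
- move=> P Sigma M [_ ricP mS <- Sf]; split.
    have [X oX XS] := moment_optimal hS ricP mS.
    by exists X; split=> //; rewrite /steers -Sf -XS.
  move=> det X oX; rewrite /steers -Sf -[LHS]/(state X (t1 S)).
  exact: det (optimal_moment hS oX) mS _ t1_in.
- move=> M P X Mpsd oX Xf; have mX := optimal_moment hS oX.
  have [ricP PM _ _ _] := oX; split.
    by exists (state X).
  by move=> det Sigma mS; split=> //; rewrite (det _ _ mS mX _ t1_in).
- move=> P Sigma M [_ ricP mS <- Sf].
  exact: steering_value_tpbvp mS Sf.
Qed.
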